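(* Let $V:\mathbb{R}^n\to\mathbb{R}$ be locally Lipschitz continuous, bounded below and coercive. Let $(x^k)_{k\in\mathbb{N}}$ be the iterates produced by the randomised Itoh--Abe method for $V$ with starting point $x^0\in\mathbb{R}^n$, time steps $(\tau_k)_{k\in\mathbb{N}}\subset[\tau_{\min},\tau_{\max}]$, where $0<\tau_{\min}\leq\tau_{\max}<\infty$, and directions $(d^k)_{k\in\mathbb{N}}$ drawn independently from a probability distribution $\Xi$ on $S^{n-1}$, and suppose that the support of the density of $\Xi$ is dense in $S^{n-1}$. Let $S$ be the set of accumulation points of $(x^k)_{k\in\mathbb{N}}$ and let $X=\{x\in\mathbb{R}^n: 0\notin\partial V(x)\}$, where $\partial V$ is the Clarke subdifferential. Then $$\mathbb{P}(S\cap X\neq\varnothing)=0,$$ i.e. the limit set $S$ is almost surely contained in the set of Clarke stationary points of $V$.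
   Context: $S^{n-1}=\{x\in\mathbb{R}^n:\|x\|=1\}$ with the Euclidean norm. $V$ is coercive if $\{x\in\mathbb{R}^n: V(x)\leq M\}$ is compact for every $M\in\mathbb{R}$. The Clarke directional derivative is $$V^o(x;d)=\limsup_{y\to x,\ \lambda\downarrow0}\frac{V(y+\lambda d)-V(y)}{\lambda},$$ the Clarke subdifferential is $\partial V(x)=\{p\in\mathbb{R}^n: V^o(x;d)\geq\langle d,p\rangle\text{ for all }d\in\mathbb{R}^n\}$, and $x$ is Clarke stationary if $0\in\partial V(x)$. Randomised Itoh--Abe method: given $x^0\in\mathbb{R}^n$, directions $(d^k)_{k\in\mathbb{N}}\subset S^{n-1}$ and time steps $(\tau_k)_{k\in\mathbb{N}}$, at step $k=0,1,2,\ldots$ set $x^{k+1}=x^k-\tau_k\beta_k d^k$, where $\beta_k\neq0$ is a solution of $$\beta_k=-\frac{V(x^k-\tau_k\beta_k d^k)-V(x^k)}{\tau_k\beta_k};$$ if no such nonzero $\beta_k$ exists, set $x^{k+1}=x^k$. If several solutions exist, one is chosen (measurably) at step $k$, without knowledge of the directions $d^{k+1},d^{k+2},\ldots$ drawn later; in particular $d^k$ is independent of $(x^0,\ldots,x^k)$. The starting point and the time steps are deterministic inputs. That the support of the density of $\Xi$ is dense in $S^{n-1}$ is understood in the measure-theoretic sense: every nonempty (relatively) open subset of $S^{n-1}$ has positive $\Xi$-probability. *)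

(* Defs.v *)
From HB Require Import structures.
From mathcomp Require Import all_boot all_order all_algebra.
From mathcomp Require Import all_classical all_reals all_analysis.

Set Implicit Arguments.
Unset Strict Implicit.
Unset Printing Implicit Defensive.

Import Order.TTheory GRing.Theory Num.Theory.
Import numFieldNormedType.Exports.

Local Open Scope classical_set_scope.
Local Open Scope ring_scope.

Definition dotv {R : realType} {n : nat} (x y : 'rV[R]_n) : R :=
  \sum_(i < n) x ord0 i * y ord0 i.

(* The norm `|x| of the library on 'rV[R]_n is the sup norm; it induces the
   same topology as [enorm]. *)
Definition enorm {R : realType} {n : nat} (x : 'rV[R]_n) : R :=
  Num.sqrt (dotv x x).

Definition sphere (R : realType) (n : nat) : set 'rV[R]_n :=
  [set x | enorm x = 1].
Arguments sphere : clear implicits.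

(* R^n with its Borel sigma-algebra. *)
Notation borel_rV R n := (g_sigma_algebraType (@open 'rV[R]_n)).

Definition locally_lipschitz {R : realType} {n : nat} (V : 'rV[R]_n -> R) :=
  forall x : 'rV[R]_n, exists2 U, nbhs x U &
    exists L, forall y z : 'rV[R]_n, U y -> U z -> `|V y - V z| <= L * enorm (y - z).

Definition coercive {R : realType} {n : nat} (V : 'rV[R]_n -> R) :=
  forall M, compact [set x | V x <= M].

Definition clarke_dd {R : realType} {n : nat} (V : 'rV[R]_n -> R)
    (x d : 'rV[R]_n) : \bar R :=
  limf_esup (fun p : 'rV[R]_n * R => ((V (p.1 + p.2 *: d) - V p.1) / p.2)%:E)
            (filter_prod (nbhs x) (0 : R)^'+).

Definition clarke_subdiff {R : realType} {n : nat} (V : 'rV[R]_n -> R)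
    (x : 'rV[R]_n) : set 'rV[R]_n :=
  [set p | forall d, ((dotv d p)%:E <= clarke_dd V x d)%E].

Definition clarke_stationary {R : realType} {n : nat} (V : 'rV[R]_n -> R)
    (x : 'rV[R]_n) := clarke_subdiff V x 0.

Definition IA_solution {R : realType} {n : nat} (V : 'rV[R]_n -> R) (tau : R)
    (d x : 'rV[R]_n) (b : R) :=
  b != 0 /\ b = - ((V (x - (tau * b) *: d) - V x) / (tau * b)).

(* A relation between x^k and x^{k+1}, since the nonzero solution need not be
   unique. *)
Definition IA_step {R : realType} {n : nat} (V : 'rV[R]_n -> R) (tau : R)
    (d x x' : 'rV[R]_n) :=
  (exists2 b, IA_solution V tau d x b & x' = x - (tau * b) *: d) \/
  ((forall b, ~ IA_solution V tau d x b) /\ x' = x).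

Definition mutually_independent d d' (T : measurableType d)
    (T' : measurableType d') (R : realType) (P : probability T R)
    (Y : nat -> {RV P >-> T'}) :=
  forall (J : seq nat) (B : nat -> set T'), uniq J ->
    (forall j, measurable (B j)) ->
    P (\big[setI/setT]_(j <- J) (Y j @^-1` B j)) =
    (\prod_(j <- J) P (Y j @^-1` B j))%E.

Definition filtration d (T : measurableType d) (F : nat -> set_system T) :=
  [/\ forall k, sigma_algebra setT (F k),
      forall k, F k `<=` measurable &
      forall k, F k `<=` F k.+1].

Definition measurable_wrt d' (T : Type) (T' : measurableType d')
    (G : set_system T) (f : T -> T') :=
  forall B, measurable B -> G (f @^-1` B).

Definition independent_of d d' (T : measurableType d) (T' : measurableType d')
    (R : realType) (P : probability T R) (G : set_system T)
    (f : T -> T') :=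
  forall A B, G A -> measurable B ->
    P (A `&` f @^-1` B) = (P A * P (f @^-1` B))%E.

Definition iid_directions d (T : measurableType d) (R : realType) (n : nat)
    (P : probability T R) (Xi : probability (borel_rV R n) R)
    (D : nat -> {RV P >-> borel_rV R n}) :=
  [/\ forall k w, sphere R n (D k w),
      forall k B, measurable B -> distribution P (D k) B = Xi B &
      mutually_independent D].

(* [F k] is the information available before d^k is drawn. The solution used at
   step k is chosen after d^k and before d^{k+1}, possibly with additional
   randomness; as d^k is a unit vector, beta_k is recovered from x^k, d^k and
   x^{k+1}, so its measurability is that of x^{k+1} with respect to F (k+1). *)
Definition randomised_IA d (T : measurableType d) (R : realType) (n : nat)
    (P : probability T R) (V : 'rV[R]_n -> R) (x0 : 'rV[R]_n) (tau : nat -> R)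
    (D : nat -> {RV P >-> borel_rV R n}) (F : nat -> set_system T)
    (x : nat -> T -> 'rV[R]_n) :=
  [/\ filtration F,
      forall k, measurable_wrt (F k.+1) (D k),
      forall k, independent_of P (F k) (D k),
      forall k, measurable_wrt (F k) (x k : T -> borel_rV R n) &
      forall w, x 0%N w = x0 /\
        forall k, IA_step V (tau k) (D k w) (x k w) (x k.+1 w)].

(* Main.v *)
Require Import Defs.
From HB Require Import structures.
From mathcomp Require Import all_boot all_order all_algebra.
From mathcomp Require Import all_classical all_reals all_analysis.
From mathcomp Require Import measurable_realfun.
From mathcomp Require Import ring lra.

Import Order.TTheory GRing.Theory Num.Theory.
Import numFieldNormedType.Exports.

Local Open Scope classical_set_scope.
Local Open Scope ring_scope.

(** Let [y] be a point that is not Clarke stationary. Then some Clarke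
derivative at [y] is negative, and since it is an upper limit over base points
as well as step lengths, the decrease it expresses is uniform: moving by [l]
from any point near [y] lowers [V] by a fixed multiple of [l], as long as [l]
is small. Local Lipschitz continuity allows the direction to vary a little, so
the same holds for all unit vectors in a nonempty relatively open set [W] of
the sphere ([nonstationary_descent]).

If the iterate is near [y] and the drawn direction falls in [W], a nonzero
solution of the step equation exists by the intermediate value theorem, and
every solution gives a displacement bounded away from zero. A displacement [s]
lowers [V] by exactly [s ^+ 2 / tau], so such a step lowers [V] by at least a
fixed [eta > 0] ([IA_step_drop]). As [V] never increases along the iterates and
is bounded below, there are at most [c := (V x0 - inf V) / eta] such steps on
every trajectory.

The direction at step [k] is independent of the past, so the expected number of
such steps is [p * \sum_k P (x k near y)], where [p > 0] is the probability of
[W]. Hence [\sum_k P (x k near y) <= c / p] is finite, and by the first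
Borel-Cantelli lemma almost surely only finitely many iterates lie near [y]
([lim_sup_set_null_of_hits], [nonstationary_visits_null]).

Finally, the event that some accumulation point is non-stationary is a countable
union, over balls with rational centre and radius, of null events of the form
[x k] visits the ball infinitely often. One inclusion holds since the
non-stationary points form an open set, the other since the iterates stay in a
compact sublevel set of [V]. *)

(** * The Euclidean norm and locally Lipschitz functions *)

Lemma enormZ {R : realType} {n : nat} (a : R) (x : 'rV[R]_n) :
  enorm (a *: x) = `|a| * enorm x.
Proof.
rewrite /enorm -sqrtr_sqr -sqrtrM ?sqr_ge0//; congr (Num.sqrt _).
rewrite /dotv mulr_sumr; apply: eq_bigr => i _; rewrite !mxE; ring.
Qed.

(** The topology of the row vectors is given by the sup norm, the
hypotheses and the sphere by the Euclidean one; this inequality is the bridge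
that the estimates need: unit vectors have sup norm at most one. *)
Lemma norm_le_enorm {R : realType} {n : nat} (x : 'rV[R]_n) : `|x| <= enorm x.
Proof.
rewrite /Num.norm/= mx_normrE; apply: bigmax_le; first exact: sqrtr_ge0.
move=> [i j] _ /=; rewrite ord1 -sqrtr_sqr; apply: ler_wsqrtr.
rewrite /dotv (bigD1 j)//= -expr2 lerDl.
by apply: sumr_ge0 => k _; rewrite -expr2 sqr_ge0.
Qed.

Lemma enorm_gt0 {R : realType} {n : nat} (x : 'rV[R]_n) :
  x != 0 -> 0 < enorm x.
Proof. by move=> x0; apply: lt_le_trans (norm_le_enorm x); rewrite normr_gt0. Qed.

Lemma enorm_continuous {R : realType} {n : nat} :
  continuous (@enorm R n).
Proof.
move=> x; apply: (@continuous_comp _ _ _ (fun x : 'rV[R]_n => dotv x x) Num.sqrt);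
  last exact: sqrt_continuous.
apply: continuous_big; first exact: add_continuous.
by move=> i _ y; apply: (@continuousM R _ (fun v : 'rV[R]_n => v ord0 i));
  exact: coord_continuous.
Qed.

Lemma open_enorm_ball {R : realType} {n : nat} (c : 'rV[R]_n) (e : R) :
  open [set v : 'rV[R]_n | enorm (v - c) < e].
Proof.
apply: (@open_comp _ _ (fun v : 'rV[R]_n => enorm (v - c)) [set r : R | r < e]);
  last exact: open_lt.
move=> v _; apply: (@continuous_comp _ _ _ (fun z : 'rV[R]_n => z - c) (@enorm R n)).
  apply: (@continuousB _ _ _ id (cst c)); [exact: cvg_id|exact: cst_continuous].
exact: enorm_continuous.
Qed.

Lemma enormBB {R : realType} {n : nat} (x : 'rV[R]_n) : enorm (x - x) = 0.
Proof. by rewrite subrr -(scale0r (0 : 'rV_n)) enormZ normr0 mul0r. Qed.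

Lemma closed_sphere {R : realType} {n : nat} : closed (sphere R n).
Proof.
apply: (@closed_comp _ _ (@enorm R n) [set (1 : R)]); last exact: closed_eq.
by move=> v _; exact: enorm_continuous.
Qed.

Lemma locally_lipschitz_continuous {R : realType} {n : nat} (V : 'rV[R]_n -> R) :
  locally_lipschitz V -> continuous V.
Proof.
move=> Vl x; have [U Ux [L VL]] := Vl x.
apply/(@cvgrPdistC_lt _ _ _ (nbhs x) (nbhs_filter x)) => e e0.
have e1 : 0 < e / (`|L| + 1) by rewrite divr_gt0// ltr_wpDl.
have nx : nbhs x [set z | enorm (z - x) < e / (`|L| + 1)].
  by apply: (open_nbhs_nbhs (conj (open_enorm_ball x _) _)); rewrite /= enormBB.
apply: (@filterS2 _ (nbhs x) _ _ _ _ _ Ux nx) => z /= Uz ex.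
apply: le_lt_trans (VL _ _ Uz (nbhs_singleton Ux)) _.
apply: (@le_lt_trans _ _ ((`|L| + 1) * enorm (z - x))).
  apply: ler_wpM2r; first exact: sqrtr_ge0.
  by rewrite (le_trans (ler_norm _))// lerDl.
by rewrite mulrC -ltr_pdivlMr// ltr_wpDl.
Qed.

(** * Non-stationary points *)

(** The upper limit defining the Clarke derivative runs jointly over base
points and step lengths, so its negativity is a decrease at a linear rate that
is uniform over a neighbourhood of base points. *)
Lemma clarke_dd_lt0P {R : realType} {n : nat} (V : 'rV[R]_n -> R)
    (y d : 'rV[R]_n) :
  (clarke_dd V y d < 0)%E <->
  exists r e, [/\ 0 < r, 0 < e & forall z l, `|z - y| < r -> 0 < l < r ->
    V (z + l *: d) <= V z - e * l].
Proof.
split=> [|[r [e [r0 e0 H]]]].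
  rewrite /clarke_dd /limf_esup => /ereal_inf_lt[s [A [[U L] [/= Uy L0] ULA] <-]].
  set q := fun p : 'rV[R]_n * R => _ => sup0.
  have [e e0 qe] : exists2 e, 0 < e & forall p, A p ->
      (V (p.1 + p.2 *: d) - V p.1) / p.2 <= - e.
    have qs p : A p -> (q p <= ereal_sup (q @` A))%E.
      by move=> Ap; apply: ereal_sup_ubound; exists p.
    case: (ereal_sup _) sup0 qs => [t| |]//= s0 qs; rewrite ?lte_fin in s0.
      by exists (- t); rewrite ?oppr_gt0// => p /qs; rewrite lee_fin opprK.
    (* no value of a real-valued quotient lies below -oo: here A is empty *)
    by exists 1 => // p /qs; rewrite leeNy_eq.
  have [r1 r10 r1U] := (nbhs_normP y U).1 Uy.
  have [r2 r20 r2L] : exists2 r2, 0 < r2 & forall l, 0 < l < r2 -> L l.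
    have [r2 /= r20 h] := L0; exists r2 => // l /andP[l0 lr]; apply: h => //=.
    by rewrite sub0r normrN gtr0_norm.
  exists (Num.min r1 r2), e; split => //; first by rewrite lt_min r10.
  move=> z l; rewrite lt_min => /andP[zr _] /andP[l0]; rewrite lt_min => /andP[_ lr].
  have Azl : A (z, l).
    apply: ULA; split => /=; last by apply: r2L; rewrite l0.
    by apply: r1U; rewrite /ball_/= distrC.
  by have := qe _ Azl; rewrite /= ler_pdivrMr// lerBlDl mulNr.
have Hr : filter_prod (nbhs y) (0 : R)^'+
    [set p | `|p.1 - y| < r /\ 0 < p.2 < r].
  exists ([set z | `|z - y| < r], [set l | 0 < l < r]) => //=; split.
    by apply: (nbhs_normP y _).2; exists r => // z /=; rewrite /ball_/= distrC.
  exists r => //= l; rewrite /ball_/= sub0r normrN => lr l0.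
  by rewrite l0 (le_lt_trans (ler_norm _)).
apply: (@le_lt_trans _ _ (- e)%:E); last by rewrite lte_fin oppr_lt0.
apply: (@le_trans _ _ (ereal_sup _)).
  by apply: ereal_inf_lbound; eexists; first exact: Hr.
apply: ub_ereal_sup => _ [[z l]/= [zr /andP[l0 lr]] <-].
rewrite lee_fin ler_pdivrMr// lerBlDl mulNr; apply: H => //.
by rewrite l0.
Qed.

Lemma nonstationaryP {R : realType} {n : nat} (V : 'rV[R]_n -> R)
    (y : 'rV[R]_n) :
  ~ clarke_subdiff V y 0 <-> exists d, (clarke_dd V y d < 0)%E.
Proof.
have d0 (d : 'rV[R]_n) : dotv d 0 = 0.
  by rewrite /dotv big1// => i _; rewrite mxE mulr0.
split=> [/existsNP[d]|[d Vd] /(_ d)]; rewrite d0.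
  by move/negP; rewrite -ltNge => ?; exists d.
by rewrite leNgt Vd.
Qed.

(** The non-stationary points form an open set: the uniform decrease around
[y] is also a uniform decrease around every point near [y]. *)
Lemma nonstationary_near {R : realType} {n : nat} (V : 'rV[R]_n -> R)
    (y : 'rV[R]_n) : ~ clarke_subdiff V y 0 ->
  exists2 r, 0 < r & forall z, `|z - y| < r -> ~ clarke_subdiff V z 0.
Proof.
move=> /nonstationaryP[d /clarke_dd_lt0P[r [e [r0 e0 H]]]].
exists (r / 2) => [|z zy]; first by rewrite divr_gt0.
apply/nonstationaryP; exists d; apply/clarke_dd_lt0P.
exists (r / 2), e; split => // [|z' l z'z /andP[l0 lr]]; first by rewrite divr_gt0.
apply: H; last by lra.
by have := ler_distD z z' y; lra.
Qed.

(** Two normalisations turn a direction of negative Clarke derivative into a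
set of directions that is hit with positive probability: scaling it to the
sphere, and perturbing it, where the Lipschitz bound costs at most half of the
rate of decrease. The sign is that of the method, which moves along [- v]. *)
Lemma nonstationary_descent {R : realType} {n : nat} (V : 'rV[R]_n -> R)
    (y : 'rV[R]_n) :
  locally_lipschitz V -> ~ clarke_subdiff V y 0 ->
  exists r e (W : set 'rV[R]_n),
    [/\ 0 < r, 0 < e, open W, W `&` sphere R n !=set0 &
     forall z v l, `|z - y| < r -> W v -> sphere R n v -> 0 < l < r ->
       V (z - l *: v) <= V z - e * l].
Proof.
move=> Vlip /nonstationaryP[d /clarke_dd_lt0P[r1 [e1 [r10 e10 H]]]].
have [U Uy [L VL]] := Vlip y.
have [r2 r20 r2U] := (nbhs_normP y U).1 Uy.
have d0 : d != 0.
  apply/eqP => d0; have := H y (r1 / 2).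
  rewrite subrr normr0 d0 scaler0 addr0 => /(_ r10 _).
  have : 0 < e1 * (r1 / 2) by rewrite mulr_gt0// divr_gt0.
  by move=> h1 h2; have := h2 ltac:(lra); lra.
set a := enorm d; have a0 : 0 < a := enorm_gt0 _ d0.
(* The method subtracts multiples of the drawn vector, hence the sign. *)
pose c := - (a^-1 *: d).
have cS : sphere R n c.
  rewrite /sphere/= /c -scaleN1r !enormZ normrN1 mul1r gtr0_norm ?invr_gt0//.
  by rewrite mulVf// gt_eqF.
(* The rate along the unit vector is e1 / a; the other half of it absorbs the
   perturbation of the direction. *)
pose e := e1 / a / 2; have e0 : 0 < e by rewrite !divr_gt0.
(* For |z - y| < r and l < r, the step l / a stays below r1 and both end points
   stay within r2 of y. *)
pose r := Num.min (Num.min r1 (r1 * a)) (r2 / 2).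
have r0 : 0 < r by rewrite !lt_min r10 mulr_gt0//= divr_gt0.
have L1 : 0 < `|L| + 1 by rewrite ltr_wpDl.
exists r, e, [set v | enorm (v - c) < e / (`|L| + 1)]; split => //.
- exact: open_enorm_ball.
- by exists c; split => //=; rewrite enormBB divr_gt0.
move=> z v l zy /= vc vS /andP[l0].
move: zy; rewrite /r !lt_min => /andP[/andP[zr1 _] zr2] /andP[/andP[_ lr1] lr2].
have U_of u : sphere R n u -> U (z - l *: u).
  move=> uS; apply: r2U => /=.
  have -> : y - (z - l *: u) = (y - z) + l *: u by rewrite opprB addrCA addrC.
  apply: le_lt_trans (ler_normD _ _) _; rewrite distrC normrZ gtr0_norm//.
  have : l * `|u| <= l * 1.
    by rewrite ler_pM2l// -[1]uS norm_le_enorm.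
  by lra.
have Hc : V (z - l *: c) <= V z - 2 * e * l.
  have := H z (l / a) zr1; rewrite divr_gt0//= ltr_pdivrMr// => /(_ lr1).
  rewrite /c scalerN opprK scalerA => /le_trans; apply.
  by rewrite /e (_ : _ * l = e1 * (l / a))//; field; rewrite gt_eqF.
have := VL _ _ (U_of _ vS) (U_of _ cS).
have -> : z - l *: v - (z - l *: c) = (- l) *: (v - c).
  by rewrite scaleNr scalerBr !opprB addrC addrA subrK.
rewrite enormZ normrN (gtr0_norm l0) => VL1.
have : L * (l * enorm (v - c)) <= e * l.
  rewrite mulrCA mulrC ler_pM2r//.
  apply: le_trans (_ : (`|L| + 1) * enorm (v - c) <= _).
    apply: ler_wpM2r; first exact: sqrtr_ge0.
    by rewrite (le_trans (ler_norm _))// lerDl.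
  by rewrite mulrC -ler_pdivlMr// ltW.
by move: VL1; rewrite ler_norml => /andP[_]; lra.
Qed.

(** * One step of the method *)

(** In terms of the displacement [s = tau * b] the step equation says that
[V] decreases by exactly [s ^+ 2 / tau]. *)
Lemma IA_solutionE {R : realType} {n : nat} (V : 'rV[R]_n -> R) (tau : R)
    (d x : 'rV[R]_n) (b : R) : 0 < tau ->
  IA_solution V tau d x b <->
  tau * b != 0 /\ V (x - (tau * b) *: d) = V x - (tau * b) ^+ 2 / tau.
Proof.
move=> tau0; rewrite /IA_solution mulf_eq0 (gt_eqF tau0)/=.
have tau1 : tau != 0 by rewrite lt0r_neq0.
split=> -[b0 Hb]; split=> //.
  have s0 : tau * b != 0 by exact: mulf_neq0.
  have -> : (tau * b) ^+ 2 / tau = tau * b * b by field.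
  have := congr1 ( *%R (tau * b)) Hb.
  by rewrite mulrN [X in _ = - X]mulrC mulfVK// => ?; lra.
rewrite Hb; field; exact/andP.
Qed.

Lemma IA_step_monotone {R : realType} {n : nat} (V : 'rV[R]_n -> R) (tau : R)
    (d x x' : 'rV[R]_n) : 0 < tau -> IA_step V tau d x x' -> V x' <= V x.
Proof.
move=> tau0 [[b /IA_solutionE[//|_ Vb] ->]|[_ ->]//].
by rewrite Vb gerBl divr_ge0// ?sqr_ge0// ltW.
Qed.

(** The function [h s = s ^+ 2 / tau + (V (x - s *: d) - V x)] is negative for
small [s > 0], where the linear decrease of [V] beats the quadratic term, and
nonnegative for large [s], where the quadratic term beats the lower bound on
[V]; its zeros are the displacements solving the step equation. *)
Lemma IA_solution_exists {R : realType} {n : nat} (V : 'rV[R]_n -> R)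
    (m tau r e : R) (d x : 'rV[R]_n) :
  continuous V -> (forall y, m <= V y) -> 0 < tau -> 0 < r -> 0 < e ->
  (forall l, 0 < l < r -> V (x - l *: d) <= V x - e * l) ->
  exists b, IA_solution V tau d x b.
Proof.
move=> Vc Vm tau0 r0 e0 H.
pose h s := s ^+ 2 / tau + (V (x - s *: d) - V x).
have [a [a0 ar aet]] : exists a, [/\ 0 < a, a < r & a < e * tau].
  have et0 : 0 < e * tau by rewrite mulr_gt0.
  have m0 : 0 < Num.min r (e * tau) by rewrite lt_min r0.
  exists (Num.min r (e * tau) / 2); split; first by rewrite divr_gt0.
    have : Num.min r (e * tau) <= r by rewrite ge_min lexx.
    by lra.
  have : Num.min r (e * tau) <= e * tau by rewrite ge_min lexx orbT.
  by lra.
(* Since c >= 1, c ^+ 2 >= c >= tau * (V x - m). *)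
pose c := a + 1 + tau * (V x - m).
have Vxm : 0 <= tau * (V x - m) by rewrite mulr_ge0 ?subr_ge0// ltW.
have ac : a <= c by rewrite /c; lra.
have ha : h a <= 0.
  have := H a; rewrite a0 => /(_ ar).
  have : a ^+ 2 / tau <= e * a.
    by rewrite ler_pdivrMr// expr2 mulrAC ler_pM2r// ltW.
  by rewrite /h; lra.
have hc : 0 <= h c.
  have : V x - m <= c ^+ 2 / tau.
    rewrite ler_pdivlMr// mulrC expr2; apply: (@le_trans _ _ c).
      by rewrite /c; lra.
    by rewrite ler_peMl// /c; lra.
  by have := Vm (x - c *: d); rewrite /h; lra.
have hcont : continuous h.
  move=> s; rewrite /h; apply: cvgD.
    by apply: cvgM; [exact: exprn_continuous|exact: cvg_cst].
  apply: cvgB; last exact: cvg_cst.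
  apply: (@continuous_comp _ _ _ (fun s : R => x - s *: d) V); last exact: Vc.
  apply: cvgB; first exact: cvg_cst.
  exact: scalel_continuous.
have [s sac hs] : exists2 s, s \in `[a, c] & h s = 0.
  apply: IVT => //; first exact: continuous_subspaceT.
  by rewrite ge_min ha le_max hc orbT.
have s0 : s != 0 by move: sac; rewrite in_itv/= => /andP[? _]; rewrite gt_eqF//; lra.
have sE : tau * (s / tau) = s by rewrite mulrC mulfVK// gt_eqF.
exists (s / tau); apply/IA_solutionE => //; rewrite sE; split => //.
by move: hs; rewrite /h; lra.
Qed.

(** Whichever solution is chosen, its displacement [s] is not small. For a
small [s > 0] the decrease [s ^+ 2 / tau] is at least [e * s], so
[s >= e * tau]. For a small [s < 0], moving by [- s] along [- d] from the new
point leads back to [x], so [V] would have increased in the step. *)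
Lemma IA_step_drop {R : realType} {n : nat} (V : 'rV[R]_n -> R)
    (m tau tau_min tau_max r e : R) (y d x x' : 'rV[R]_n) :
  continuous V -> (forall y, m <= V y) ->
  0 < tau_min -> tau_min <= tau <= tau_max -> 0 < r -> 0 < e ->
  sphere R n d ->
  (forall z l, `|z - y| < r -> 0 < l < r -> V (z - l *: d) <= V z - e * l) ->
  `|x - y| < r / 2 -> IA_step V tau d x x' ->
  V x' <= V x - Num.min (r / 2) (e * tau_min) ^+ 2 / tau_max.
Proof.
move=> Vc Vm tm0 /andP[tmt ttM] r0 e0 dS H xy.
have tau0 : 0 < tau by lra.
have xr : `|x - y| < r by lra.
case=> [[b /IA_solutionE[//|s0 Vb] ->]|[nsol _]]; last first.
  have [b /nsol//] : exists b, IA_solution V tau d x b.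
  by apply: (IA_solution_exists V m tau r e d x Vc) => // l; exact: H.
rewrite Vb lerD2l lerN2; move: (tau * b) s0 Vb => s s0 Vb.
set k := Num.min _ _.
have k0 : 0 < k by rewrite lt_min divr_gt0//= mulr_gt0.
have ks : k <= `|s|.
  rewrite leNgt; apply/negP; rewrite lt_min => /andP[sr set].
  have [spos|sneg] := ltrP 0 s.
    rewrite gtr0_norm// in sr set.
    have := H x s xr; rewrite Vb spos => /(_ ltac:(lra)).
    rewrite lerD2l lerN2 ler_pdivlMr// expr2 mulrAC ler_pM2r//.
    have : e * tau_min <= e * tau by rewrite ler_pM2l.
    by lra.
  have {s0 sneg} sneg : s < 0 by rewrite lt_neqAle s0.
  rewrite ltr0_norm// in sr set.
  have sd : `|s *: d| <= - s.
    rewrite normrZ ltr0_norm// -[leRHS]mulr1 ler_pM2l ?oppr_gt0//.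
    by rewrite -dS norm_le_enorm.
  have zy : `|x - s *: d - y| < r.
    rewrite addrAC; apply: le_lt_trans (ler_normB _ _) _; lra.
  have := H _ (- s) zy; rewrite scaleNr opprK subrK Vb.
  have : 0 < e * - s by rewrite mulr_gt0// oppr_gt0.
  have : 0 <= s ^+ 2 / tau by rewrite divr_ge0 ?sqr_ge0// ltW.
  by move=> h1 h2 /(_ ltac:(lra)); lra.
apply: (@le_trans _ _ (k ^+ 2 / tau)).
  rewrite ler_wpM2l ?sqr_ge0// lef_pV2// posrE; lra.
rewrite ler_wpM2r ?invr_ge0 ?(ltW tau0)// -(real_normK (num_real s)).
by rewrite lerXn2r ?nnegrE// ltW.
Qed.

(** * Infinitely many visits *)

(** Summing the product rule bounds [p * \sum_k P (A k)] by the expected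
number of indices at which [A k] and [B k] both occur, so a bound on that number
makes the first Borel-Cantelli lemma applicable to [A]. *)
Lemma lim_sup_set_null_of_hits {d} {T : measurableType d} {R : realType}
    (P : probability T R) (A B : nat -> set T) (p c : R) :
  (forall k, measurable (A k)) -> (forall k, measurable (B k)) -> 0 < p ->
  (forall k, P (A k `&` B k) = (P (A k) * p%:E)%E) ->
  (forall K w, \sum_(0 <= k < K) \1_(A k `&` B k) w <= c) ->
  P (lim_sup_set A) = 0%E.
Proof.
move=> mA mB p0 PAB hits; apply: lim_sup_set_cvg0 => //.
have mAB k : measurable (A k `&` B k) by exact: measurableI.
have sumP K : (\sum_(0 <= k < K) P (A k) <= (c / p)%:E)%E.
  suff : (\sum_(0 <= k < K) P (A k `&` B k) <= c%:E)%E.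
    under eq_bigr do rewrite PAB.
    by rewrite -ge0_sume_distrl// EFinM lee_pdivlMr.
  have m1 k : measurable_fun setT (\1_(A k `&` B k) : T -> R).
    exact: measurable_indic.
  have -> : (\sum_(0 <= k < K) P (A k `&` B k) =
             \int[P]_w \sum_(0 <= k < K) (\1_(A k `&` B k) w)%:E)%E.
    rewrite ge0_integral_sum//; last first.
      by move=> k; apply/measurable_EFinP; exact: m1.
    by apply: eq_bigr => k _; rewrite integral_indic// setIT.
  rewrite -[leRHS]mule1 -(probability_setT P) -integral_cst//.
  apply: ge0_le_integral => //.
  - by move=> w _; apply: sume_ge0 => k _; rewrite lee_fin.
  - by apply: emeasurable_sum => k; apply/measurable_EFinP; exact: m1.
  - by move=> w _; rewrite sumEFin lee_fin.
apply: (@le_lt_trans _ _ (c / p)%:E); last exact: ltry.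
apply: lime_le; first exact: is_cvg_nneseries.
by apply: nearW.
Qed.

(** Compactness is applied to the image of [\oo] restricted to the indices
of the visits to [B], that is, to a subsequence lying in [B]. *)
Lemma io_cluster {T : topologicalType} (u : nat -> T) (B K : set T) :
  compact K -> (forall k, K (u k)) ->
  (forall N, exists2 k, (N <= k)%N & B (u k)) ->
  exists2 y, cluster (u @ \oo) y & closure B y.
Proof.
move=> cK uK io; pose F := u @ within [set k | B (u k)] \oo.
have FF : ProperFilter F.
  split; last exact: fmap_filter.
  by move=> [N _ h]; have [k Nk Bk] := io N; exact: (h k Nk Bk).
have [|y [_ Fy]] := cK F FF; first by exists 0%N => // k _ _; exact: uK.
exists y.
  move=> G U [N _ NG] yU; apply: Fy => //.
  by exists N => // k Nk _; exact: NG.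
by move=> U yU; apply: Fy => //; exists 0%N.
Qed.

Lemma cluster_io {T : topologicalType} (u : nat -> T) (U : set T) (y : T) :
  cluster (u @ \oo) y -> nbhs y U ->
  forall N, exists2 k, (N <= k)%N & U (u k).
Proof.
move=> uy yU N; have [_ [[k Nk <-] Uk]] := uy (u @` [set k | (N <= k)%N]) U
  ltac:(by exists N => // k Nk; exists k) yU.
by exists k.
Qed.

(** The factor 2 makes the neighbourhood condition cover the closure of the
rational ball, where accumulation points of visits to it lie. *)
Lemma rat_ball_near {R : realType} {n : nat} (y : 'rV[R]_n) (r : R) : 0 < r ->
  exists (q : 'rV[rat]_n) (j : nat), `|y - map_mx ratr q| < j.+1%:R^-1 /\
    forall z, `|z - map_mx ratr q| < 2 * j.+1%:R^-1 -> `|z - y| < r.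
Proof.
move=> r0.
(* Any z in the doubled ball is within (2 + 1) / j.+1 of y. *)
have [j jr] : exists j, 3 * j.+1%:R^-1 < r :> R.
  have r30 : 0 < r / 3 by rewrite divr_gt0.
  have [N _ /(_ N (leqnn N)) /= Nr] := near_infty_natSinv_lt (PosNum r30).
  by exists N; move: Nr; rewrite ltr_pdivlMr// mulrC.
have j0 : 0 < j.+1%:R^-1 :> R by rewrite invr_gt0.
have /choice[q Hq] i : exists q : rat, ratr q \in `]y 0 i, y 0 i + j.+1%:R^-1[.
  by apply: rat_in_itvoo; rewrite ltrDl.
exists (\row_i q i), j.
have yq : `|y - map_mx ratr (\row_i q i)| < j.+1%:R^-1.
  rewrite [X in X < _]/Num.norm/= mx_normrE; apply: bigmax_lt => // -[a i] _ /=.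
  rewrite !mxE ord1; have := Hq i; rewrite in_itv/= => /andP[h1 h2].
  by rewrite distrC ger0_norm ?subr_ge0 ?ltW// ltrBlDl.
move: (map_mx _ _) yq jr {j0 Hq}; move: (j.+1%:R^-1) => t c yc tr.
split=> // z zc.
by have := ler_distD c z y; rewrite (distrC c y); lra.
Qed.

(** Near [y], a draw in the descent directions costs the method a fixed
amount of its finite supply of decrease, so visits to a neighbourhood of [y]
cannot recur with positive probability. *)
Lemma nonstationary_visits_null {R : realType} {n : nat}
    (V : 'rV[R]_n -> R) (m : R) {d} {T : measurableType d}
    (P : probability T R) (x0 : 'rV[R]_n) (tau : nat -> R) (tau_min tau_max : R)
    (Xi : probability (borel_rV R n) R)
    (D : nat -> {RV P >-> borel_rV R n}) (F : nat -> set_system T)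
    (x : nat -> T -> 'rV[R]_n) (y : 'rV[R]_n) :
  locally_lipschitz V -> (forall z, m <= V z) ->
  0 < tau_min -> (forall k, tau_min <= tau k <= tau_max) ->
  (forall U : set 'rV[R]_n, open U -> U `&` sphere R n !=set0 ->
     (0 < Xi (U `&` sphere R n))%E) ->
  (forall k B, measurable B -> distribution P (D k) B = Xi B) ->
  randomised_IA V x0 tau D F x ->
  ~ clarke_subdiff V y 0 ->
  exists2 r, 0 < r & forall B : set 'rV[R]_n, open B ->
    (forall z, B z -> `|z - y| < r) ->
    P (lim_sup_set (fun k => x k @^-1` B)) = 0%E.
Proof.
move=> Vlip Vm tm0 tauP Xid Did [[_ Fm _] _ Dind xF xIA] yX.
have Vc := locally_lipschitz_continuous V Vlip.
have [r [e [W [r0 e0 oW W0 H]]]] := nonstationary_descent V y Vlip yX.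
exists (r / 2); first by rewrite divr_gt0.
move=> B oB Br.
have tau0 k : 0 < tau k by have /andP[? _] := tauP k; exact: lt_le_trans tm0 _.
have tM0 : 0 < tau_max by have /andP[h1 h2] := tauP 0%N; lra.
have mO (U : set 'rV[R]_n) : open U -> measurable (U : set (borel_rV R n)).
  by move=> oU; exact: sub_sigma_algebra.
have mS : measurable (sphere R n : set (borel_rV R n)).
  rewrite -[sphere R n]setCK; apply: measurableC; apply: mO.
  by rewrite openC; exact: closed_sphere.
pose WS : set (borel_rV R n) := W `&` sphere R n.
have mWS : measurable WS by apply: measurableI => //; exact: mO.
have FxB k : F k (x k @^-1` B) by apply: xF; exact: mO.
pose eta := Num.min (r / 2) (e * tau_min) ^+ 2 / tau_max.
have eta0 : 0 < eta.
  by rewrite divr_gt0// exprn_gt0// lt_min divr_gt0//= mulr_gt0.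
apply: (lim_sup_set_null_of_hits P _ (fun k => D k @^-1` WS) (fine (Xi WS))
         ((V x0 - m) / eta)).
- by move=> k; apply: Fm; exact: FxB.
- by move=> k; rewrite -[X in measurable X]setTI; exact: measurable_funPT.
- by rewrite -lte_fin fineK ?fin_num_measure//; exact: Xid.
- move=> k; rewrite fineK ?fin_num_measure// -(Did k _ mWS).
  by rewrite (Dind k)//; exact: FxB.
move=> K w; rewrite ler_pdivlMr//.
have [x0w stepw] := xIA w.
(* Each hit is paid for by a decrease eta of V along the trajectory. *)
suff : (\sum_(0 <= k < K) \1_(x k @^-1` B `&` D k @^-1` WS) w) * eta
    <= V x0 - V (x K w) by have := Vm (x K w); lra.
elim: K => [|K IH]; first by rewrite big_nil mul0r x0w subrr.
rewrite big_nat_recr//= mulrDl indicE.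
case: (boolP (w \in _)) => [|_]; last first.
  by rewrite mul0r addr0; have := IA_step_monotone V _ _ _ _ (tau0 K) (stepw K); lra.
rewrite inE => -[/= BK [WK SK]].
have Hd z l : `|z - y| < r -> 0 < l < r ->
    V (z - l *: D K w) <= V z - e * l by move=> zy; exact: H.
have := IA_step_drop V m _ _ _ _ _ y _ _ _ Vc Vm tm0 (tauP K) r0 e0 SK Hd
  (Br _ BK) (stepw K).
by rewrite -/eta mul1r; lra.
Qed.

Lemma countable_bigcup_null {d} {T : measurableType d} {R : realType}
    (P : probability T R) {I : countType} (A : I -> set T) :
  (forall i, measurable (A i)) -> (forall i, P (A i) = 0%E) ->
  measurable (\bigcup_i A i) /\ P (\bigcup_i A i) = 0%E.
Proof.
move=> mA PA; pose A' k := oapp A set0 (unpickle k).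
have mA' k : measurable (A' k) by rewrite /A'; case: (unpickle k) => [i|]//=.
have -> : \bigcup_i A i = \bigcup_k A' k.
  apply/seteqP; split=> w [i _ Aw].
    by exists (pickle i) => //; rewrite /A' pickleK.
  by move: Aw; rewrite /A'; case: (unpickle i) => //= j Aw; exists j.
have mE : measurable (\bigcup_k A' k) by exact: bigcupT_measurable.
split=> //; apply/negligibleP => //; apply: negligible_bigcup => k.
by apply/negligibleP => //; rewrite /A'; case: (unpickle k) => [i|]//=; rewrite ?PA ?measure0.
Qed.

(** * Almost sure stationarity of the accumulation points *)

Theorem theorem3p5 (R : realType) (n : nat)
    (V : 'rV[R]_n -> R)
    (V_lip : locally_lipschitz V)
    (V_bounded_below : exists m, forall y, m <= V y)
    (V_coercive : coercive V)
    (d : measure_display) (T : measurableType d) (P : probability T R)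
    (x0 : 'rV[R]_n)
    (tau : nat -> R) (tau_min tau_max : R)
    (tau_min_gt0 : 0 < tau_min)
    (tau_min_le_max : tau_min <= tau_max)
    (tau_bounds : forall k, tau_min <= tau k <= tau_max)
    (Xi : probability (borel_rV R n) R)
    (Xi_sphere : Xi (sphere R n) = 1%E)
    (Xi_dense : forall U : set 'rV[R]_n, open U -> U `&` sphere R n !=set0 ->
       (0 < Xi (U `&` sphere R n))%E)
    (D : nat -> {RV P >-> borel_rV R n})
    (D_iid : iid_directions Xi D)
    (F : nat -> set_system T)
    (x : nat -> T -> 'rV[R]_n)
    (x_IA : randomised_IA V x0 tau D F x) :
  let S (w : T) := cluster (x ^~ w @ \oo) in
  let X := [set y | ~ clarke_subdiff V y 0] in
  [/\ measurable [set w | S w `&` X !=set0],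
      P [set w | S w `&` X !=set0] = 0%E &
      {ae P, forall w, S w `<=` [set y | clarke_stationary V y]}].
Proof.
move=> S X.
have [m Vm] := V_bounded_below.
have [_ D_law _] := D_iid.
have [[_ Fm _] _ _ xF xIA] := x_IA.
pose c (i : 'rV[rat]_n * nat) : 'rV[R]_n := map_mx ratr i.1.
pose rho (i : 'rV[rat]_n * nat) : R := i.2.+1%:R^-1.
pose B i := [set z | `|z - c i| < rho i].
have oB i : open (B i).
  have -> : B i = ball (c i) (rho i).
    by apply/seteqP; split=> z; rewrite mx_norm_ball /ball_/= distrC.
  exact: ball_open.
pose io i := lim_sup_set (fun k => x k @^-1` B i).
have mio i : measurable (io i).
  apply: bigcap_measurable => // N _; apply: bigcup_measurable => k _.
  by apply: Fm; apply: xF; exact: sub_sigma_algebra.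
(* The second condition puts the closure of B i inside X. *)
pose good i := P (io i) = 0%E /\ forall z, `|z - c i| < 2 * rho i -> X z.
pose A i := [set w | good i /\ io i w].
have EA : [set w | S w `&` X !=set0] = \bigcup_i A i.
  apply/seteqP; split=> w.
    move=> [y [Sy Xy]].
    have [r r0 rnull] := nonstationary_visits_null V m P x0 tau tau_min tau_max
      Xi D F x y V_lip Vm tau_min_gt0 tau_bounds Xi_dense D_law x_IA Xy.
    have [r' r'0 r'X] := nonstationary_near V y Xy.
    have rr0 : 0 < Num.min r r' by rewrite lt_min r0.
    have [q [j [yc Hc]]] := rat_ball_near y _ rr0.
    exists (q, j) => //; split.
      split=> [|z zc].
        apply: rnull => // z Bz.
        have : `|z - y| < Num.min r r'.
          apply: Hc; apply: (lt_trans Bz).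
          by rewrite /rho/= ltr_pMl ?invr_gt0// ltr1n.
        by rewrite lt_min => /andP[].
      by apply: r'X; have := Hc z zc; rewrite lt_min => /andP[].
    move=> N _; have yB : nbhs y (B (q, j)) by apply: open_nbhs_nbhs; split.
    by have [k Nk Bk] := cluster_io _ _ _ Sy yB N; exists k.
  move=> [i _ [[_ iX] iow]].
  have [x0w stepw] := xIA w.
  (* The iterates stay in the compact sublevel set of x0. *)
  have decr k : V (x k w) <= V x0.
    elim: k => [|k IH]; first by rewrite x0w.
    apply: le_trans IH; apply: IA_step_monotone (stepw k).
    by have /andP[h _] := tau_bounds k; exact: lt_le_trans tau_min_gt0 h.
  have [|y Sy By] := io_cluster (x ^~ w) (B i) _ (V_coercive (V x0)) decr.
    by move=> N; have [k Nk Bk] := iow N I; exists k.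
  exists y; split=> //; apply: iX.
  have rho0 : 0 < rho i by rewrite invr_gt0.
  have [z [Bz zy]] := By _ (nbhsx_ballx y _ rho0).
  move: zy; rewrite mx_norm_ball /ball_/= => zy.
  by move: Bz; rewrite /B/=; have := ler_distD z y (c i); lra.
have A_good i : good i -> A i = io i.
  by move=> gi; apply/seteqP; split=> w // [].
have A_bad i : ~ good i -> A i = set0.
  by move=> gi; apply/seteqP; split=> w // [].
have mA i : measurable (A i).
  by have [/A_good->|/A_bad->] := pselect (good i).
have PA i : P (A i) = 0%E.
  have [gi|/A_bad->] := pselect (good i); last exact: measure0.
  by rewrite A_good//; exact: gi.1.
rewrite EA; have [mE PE] := countable_bigcup_null P A mA PA.
split=> //; exists (\bigcup_i A i); split=> // w /= Sw; rewrite -EA.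
have [y /not_implyP[Sy Xy]] : exists y, ~ (S w y -> clarke_stationary V y).
  exact/existsNP.
by exists y.
Qed.
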